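(* Let $\tau>0$, $\sigma>1$, let $U\subseteq\mathbb{R}^d$ be non-empty and open, and let $\mathcal{M}^{\tau,\sigma}:=\{M^{(c,\tau,\sigma)}:c>0\}$ with $M^{(c,\tau,\sigma)}_j:=c^{j^\sigma}j^{\tau j^\sigma}$, $j\in\mathbb{N}$ (with $0^0:=1$). Then $\mathcal{E}_{\{\mathcal{M}^{\tau,\sigma}\}}(U)$ does not coincide (as a vector space) with $\mathcal{E}_{\{M\}}(U)$ for any weight sequence $M$, nor with $\mathcal{E}_{\{\omega\}}(U)$ for any weight function $\omega$; likewise, $\mathcal{E}_{(\mathcal{M}^{\tau,\sigma})}(U)$ does not coincide (as a vector space) with $\mathcal{E}_{(M)}(U)$ for any weight sequence $M$, nor with $\mathcal{E}_{(\omega)}(U)$ for any weight function $\omega$.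
   Context: $\mathbb{N}=\{0,1,2,\dots\}$. A weight sequence is a sequence $M=(M_j)_j\in\mathbb{R}_{>0}^{\mathbb{N}}$. A weight function is a continuous non-decreasing $\omega:[0,\infty)\to[0,\infty)$ with $\omega(0)=0$, $\log(t)=o(\omega(t))$ as $t\to+\infty$, $\varphi_\omega:t\mapsto\omega(e^t)$ convex, and $\omega(2t)=O(\omega(t))$ as $t\to+\infty$. Its Young conjugate is $\varphi^*_\omega(s):=\sup_{t\ge 0}(st-\varphi_\omega(t))$, $s\ge 0$. $\mathcal{E}(U)$ denotes the smooth complex-valued functions on $U$. For compact $K\subset U$ and $h>0$ put $$\|f\|_{M,K,h}:=\sup_{\alpha\in\mathbb{N}^d,x\in K}\frac{|f^{(\alpha)}(x)|}{h^{|\alpha|}M_{|\alpha|}},\qquad \|f\|_{\omega,K,h}:=\sup_{\alpha\in\mathbb{N}^d,x\in K}\frac{|f^{(\alpha)}(x)|}{\exp(\frac1h\varphi^*_\omega(h|\alpha|))}.$$ - $\mathcal{E}_{\{M\}}(U)$ (resp. $\mathcal{E}_{(M)}(U)$): all $f\in\mathcal{E}(U)$ such that for every compact $K\subset U$ and some (resp. every) $h>0$, $\|f\|_{M,K,h}<\infty$. - $\mathcal{E}_{\{\omega\}}(U)$ (resp. $\mathcal{E}_{(\omega)}(U)$): all $f\in\mathcal{E}(U)$ such that for every compact $K\subset U$ and some (resp. every) $h>0$, $\|f\|_{\omega,K,h}<\infty$. - For a family $\mathcal{M}=\{M^{(x)}:x>0\}$ of positive sequences pointwise non-decreasing in $x$,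 $\mathcal{E}_{\{\mathcal{M}\}}(U)$ (resp. $\mathcal{E}_{(\mathcal{M})}(U)$): all $f\in\mathcal{E}(U)$ such that for every compact $K\subset U$ there exist $x,h>0$ with (resp. for all $x,h>0$ one has) $\|f\|_{M^{(x)},K,h}<\infty$. *)

(* Defs.v *)
(* MathComp-Analysis, over an abstract [R : realType]. *)
From HB Require Import structures.
From mathcomp Require Import all_boot all_order all_algebra complex.
From mathcomp Require Import all_classical all_reals all_analysis.

Set Implicit Arguments.
Unset Strict Implicit.
Unset Printing Implicit Defensive.

Import Order.TTheory GRing.Theory Num.Theory.
Import numFieldNormedType.Exports.

Local Open Scope classical_set_scope.
Local Open Scope ring_scope.

(* Functions on an open U are represented by total functions on R^d; everything
   below only looks at points of U, and, U being open, the derivatives there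
   depend only on the restriction to U. *)

Section Smooth.
Variables (R : realType) (d : nat).
Implicit Types (U K : set 'rV[R]_d) (g : 'rV[R]_d -> R) (f : 'rV[R]_d -> R[i]).

Definition partial (i : 'I_d) g : 'rV[R]_d -> R := 'D_(delta_mx 0 i) g.

Definition partials (s : seq 'I_d) g : 'rV[R]_d -> R := foldr partial g s.

(* C^infinity: iterated partial derivatives of all orders exist and are
   continuous.  The conditions are imposed for every list s, so each
   derivative entering [partials s g] does exist. *)
Definition real_smooth_on U g : Prop :=
  forall (s : seq 'I_d) x, U x ->
    {for x, continuous (partials s g)} /\
    forall i : 'I_d, derivable (partials s g) x (delta_mx 0 i).

(* The library has no R-normed-space structure on R[i]: complex-valued
   functions are differentiated through their real and imaginary parts. *)
Definition smooth_on U f : Prop :=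
  real_smooth_on U (fun x => complex.Re (f x)) /\
  real_smooth_on U (fun x => complex.Im (f x)).

Definition multiindex := {ffun 'I_d -> nat}.

Definition mi_order (alpha : multiindex) : nat := (\sum_i alpha i)%N.

Definition real_mi_derive (alpha : multiindex) g : 'rV[R]_d -> R :=
  foldr (fun i h => iter (alpha i) (partial i) h) g (enum 'I_d).

Definition mi_derive (alpha : multiindex) f (x : 'rV[R]_d) : R[i] :=
  Complex (real_mi_derive alpha (fun y => complex.Re (f y)) x)
          (real_mi_derive alpha (fun y => complex.Im (f y)) x).

(* Extended-real supremum; it is -oo when K is empty, which is harmless since
   these norms are only ever required to be < +oo. *)
Definition weighted_norm (W : nat -> R) K f : \bar R :=
  ereal_sup [set y | exists alpha : multiindex, exists2 x, K x &
    y = (ComplexField.Normc.normc (mi_derive alpha f x)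
           / W (mi_order alpha))%:E].

End Smooth.

(* Needed by the Landau notations at +oo. *)
Canonical pinfty_filter_on (R : numFieldType) : filter_on R :=
  FilterType (pinfty_nbhs R) _.

Section Weights.
Variable R : realType.

Definition weight_sequence (M : nat -> R) : Prop := forall j, 0 < M j.

Definition phi (omega : R -> R) (t : R) : R := omega (expR t).

(* A function [0, oo) -> [0, oo) is represented by a total function whose
   values at negative arguments are never used. *)
Record weight_function (omega : R -> R) : Prop := WeightFunction {
  wf_ge0 : forall t : R, 0 <= t -> 0 <= omega t;
  wf_continuous : {within `[0, +oo[, continuous omega};
  wf_nondecreasing : forall s t : R, 0 <= s -> s <= t -> omega s <= omega t;
  wf_0 : omega 0 = 0;
  wf_log : (@ln R : R -> R^o) =o_ (pinfty_nbhs R) (omega : R -> R^o);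
  wf_convex : convex_function setT (phi omega);
  wf_double : ((fun t => omega (2 * t)) : R -> R^o)
                =O_ (pinfty_nbhs R) (omega : R -> R^o)
}.

(* For a weight function the set is bounded above (log t = o(omega t)), so
   the real-valued [sup] is the actual supremum. *)
Definition young_conj (omega : R -> R) (s : R) : R :=
  sup [set s * t - phi omega t | t in `[0, +oo[].

Definition Mts (tau sigma c : R) (j : nat) : R :=
  c `^ (j%:R `^ sigma) * j%:R `^ (tau * j%:R `^ sigma).

End Weights.

Section Classes.
Variables (R : realType) (d : nat).
Implicit Types (U K : set 'rV[R]_d) (f : 'rV[R]_d -> R[i]).

Definition norm_seq (M : nat -> R) K (h : R) f : \bar R :=
  weighted_norm (fun j => h ^+ j * M j) K f.

Definition norm_fun (omega : R -> R) K (h : R) f : \bar R :=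
  weighted_norm (fun j => expR (h^-1 * young_conj omega (h * j%:R))) K f.

Definition roumieu_seq U (M : nat -> R) : set ('rV[R]_d -> R[i]) :=
  [set f | smooth_on U f /\ forall K, compact K -> K `<=` U ->
    exists2 h, 0 < h & (norm_seq M K h f < +oo)%E].

Definition beurling_seq U (M : nat -> R) : set ('rV[R]_d -> R[i]) :=
  [set f | smooth_on U f /\ forall K, compact K -> K `<=` U ->
    forall h, 0 < h -> (norm_seq M K h f < +oo)%E].

Definition roumieu_fun U (omega : R -> R) : set ('rV[R]_d -> R[i]) :=
  [set f | smooth_on U f /\ forall K, compact K -> K `<=` U ->
    exists2 h, 0 < h & (norm_fun omega K h f < +oo)%E].

Definition beurling_fun U (omega : R -> R) : set ('rV[R]_d -> R[i]) :=
  [set f | smooth_on U f /\ forall K, compact K -> K `<=` U ->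
    forall h, 0 < h -> (norm_fun omega K h f < +oo)%E].

(* A family of weight sequences is indexed by the reals, but only its members
   with positive index are used. *)
Definition roumieu_fam U (MM : R -> nat -> R) : set ('rV[R]_d -> R[i]) :=
  [set f | smooth_on U f /\ forall K, compact K -> K `<=` U ->
    exists x h, [/\ 0 < x, 0 < h & (norm_seq (MM x) K h f < +oo)%E]].

Definition beurling_fam U (MM : R -> nat -> R) : set ('rV[R]_d -> R[i]) :=
  [set f | smooth_on U f /\ forall K, compact K -> K `<=` U ->
    forall x h, 0 < x -> 0 < h -> (norm_seq (MM x) K h f < +oo)%E].

End Classes.

(* Main.v *)
(** Test functions f(x) = sum_n a_n exp(i l_n (x_1 - b)) with a_n, l_n >= 0 reduce
    everything to sequences: with m_j = sum_n a_n l_n^j, the sup norm of the j-th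
    derivative of f is m_j up to a factor 2 and is attained at x_1 = b, so f is
    in a class exactly when the moment sequence m is dominated by its weights.
    The sequences M^(c) and exp(phi^*(h j) / h) are, essentially, suprema of
    geometric sequences; gluing suitable geometric sequences turns an inclusion
    of classes into a domination between weights.
    Against a single sequence M: in the Roumieu case M dominates every M^(c), and
    gluing gives a moment sequence dominated by M but by no M^(c); in the Beurling
    case M dominates some M^(c), hence the Beurling class of M contains a function
    whose derivatives reach some M^(c') with c' < c, too large for the left-hand class.
    Against omega: W^(h)_(2j) = (W^(2h)_j)^2 for W^(h)_j = exp(phi^*(h j) / h), whereas
    M^(c)_(2j) outgrows (M^(c')_j)^2 for all c, c', since 2^sigma > 2. *)

Require Import Defs.
From HB Require Import structures.
From mathcomp Require Import all_boot all_order all_algebra complex.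
From mathcomp Require Import all_classical all_reals all_analysis.
From mathcomp Require Import ring lra.

Import Order.TTheory GRing.Theory Num.Theory.
Import numFieldNormedType.Exports.

Local Open Scope classical_set_scope.
Local Open Scope ring_scope.

(** * Almost periodic series in one variable *)

Section Trig.
Context {R : realType}.
Implicit Types (a l m : R^nat) (t u v th : R).

Lemma mvt_bound (f df : R -> R) (K x y : R) : 0 <= K ->
  (forall t, is_derive t 1 f (df t)) ->
  (forall t, `|t - x| <= `|y - x| -> `|df t| <= K) ->
  `|f y - f x| <= K * `|y - x|.
Proof.
move=> K0 fd dfK.
have fc t : {for t, continuous f}.
  by apply/differentiable_continuous/derivable1_diffP; case: (fd t).
have cw b c : {within `[b, c], continuous f} by apply/continuous_subspaceT => t; exact: fc.
have [xy|yx|->] := ltgtP x y; last by rewrite !subrr normr0 mulr0.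
- have [c /itvP cxy ->] := MVT xy (fun t _ => fd t) (cw _ _).
  rewrite normrM ler_wpM2r// dfK// !ger0_norm ?subr_ge0 ?(ltW xy) ?cxy//.
  by rewrite lerD2r cxy.
- have [c /itvP cxy] := MVT yx (fun t _ => fd t) (cw _ _).
  rewrite distrC => ->; rewrite normrM (distrC y x) ler_wpM2r// dfK//.
  rewrite !ler0_norm ?subr_le0 ?(ltW yx) ?cxy//.
  by rewrite lerN2 lerD2r cxy.
Qed.

Lemma sin_lipschitz u v : `|sin v - sin u| <= `|v - u| :> R.
Proof.
rewrite -[leRHS]mul1r; apply: (@mvt_bound sin cos) => // t _.
by rewrite ler_norml cos_geN1 cos_le1.
Qed.

(** The function w -> cos (u + w) + w sin u has derivative sin u - sin (u + w), of size at most |w|,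
    so the mean value bound applies. Writing - sin u as cos (u + pi / 2) matches the phase shifts in
    [trig_term]. *)
Lemma cos_taylor1 u v :
  `|cos (u + v) - cos u - v * cos (u + pi / 2)| <= v ^+ 2 :> R.
Proof.
pose f : R -> R := (cos \o shift u) + (sin u \*: id).
have fd (w : R) : is_derive w (1 : R) f (- sin (u + w) + sin u).
  apply: is_deriveD.
    apply: is_derive_eq.
    by rewrite addr0 mulr1 /= addrC.
  by apply: is_derive_eq; rewrite /GRing.scale/= mulr1.
have fE w : f w = cos (u + w) + w * sin u.
  exact: (congr2 +%R (congr1 cos (addrC _ _)) (mulrC _ _)).
have := @mvt_bound f _ `|v| 0 v (normr_ge0 _) fd.
rewrite !subr0 -normrM -expr2 ger0_norm ?sqr_ge0// cosDpihalf !fE addr0 mul0r addr0.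
have -> : cos (u + v) - cos u - v * - sin u = cos (u + v) + v * sin u - cos u by ring.
apply => t tv; rewrite addrC distrC (le_trans _ tv)// subr0.
by rewrite (le_trans (sin_lipschitz _ _))// addrAC subrr add0r.
Qed.


(** [m] is the moment sequence of the discrete measure with mass [a n] at [l n]. *)
Definition moment_system a l m : Prop :=
  [/\ forall n, 0 <= a n, forall n, 0 <= l n &
      forall j, series (fun n => a n * l n ^+ j) @ \oo --> m j].

(** Each derivative in [t] multiplies by l_n and shifts the phase by pi / 2, so [j] is the order of
    differentiation. The phases [th] = 0 and - pi / 2 will give real and imaginary parts. *)
Definition trig_term a l th j t n : R :=
  a n * l n ^+ j * cos (l n * t + th + j%:R * (pi / 2)).

Definition trig a l th j t : R := limn (series (trig_term a l th j t)).

Section moments.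
Context {a l m : R^nat} (alm : moment_system a l m).

Let a0 n : 0 <= a n. Proof. by case: alm. Qed.
Let l0 n : 0 <= l n. Proof. by case: alm. Qed.
Let alm_cvg j : cvgn (series (fun n => a n * l n ^+ j)).
Proof. by case: alm => _ _ /(_ j)/cvgP. Qed.
Let alm_lim j : limn (series (fun n => a n * l n ^+ j)) = m j.
Proof. by case: alm => _ _ /(_ j)/cvg_lim; apply. Qed.

Lemma trig_term_le th j t n : `|trig_term a l th j t n| <= a n * l n ^+ j.
Proof.
rewrite /trig_term normrM ger0_norm ?mulr_ge0 ?exprn_ge0//.
by rewrite ler_piMr ?mulr_ge0 ?exprn_ge0// ler_norml cos_geN1 cos_le1.
Qed.

Lemma trig_term_normed_cvg th j t : cvgn [normed series (trig_term a l th j t)].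
Proof.
apply: (series_le_cvg _ _ (trig_term_le th j t)) => // n.
by rewrite mulr_ge0 ?exprn_ge0.
Qed.

Lemma trig_term_cvg th j t : cvgn (series (trig_term a l th j t)).
Proof. exact: normed_cvg (trig_term_normed_cvg th j t). Qed.

Lemma trig_le th j t : `|trig a l th j t| <= m j.
Proof.
rewrite (le_trans (lim_series_norm (trig_term_normed_cvg th j t)))// -alm_lim.
by apply: lim_series_le => // n; [exact: trig_term_normed_cvg | exact: trig_term_le].
Qed.

Lemma trig_at0 th j : trig a l th j 0 = m j * cos (th + j%:R * (pi / 2)).
Proof.
rewrite /trig -alm_lim mulrC -[RHS](lim_seriesZ _ (alm_cvg j)).
congr (limn (series _)); apply/funext => n.
by rewrite /trig_term mulr0 add0r [RHS]mulrC.
Qed.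

(** Termwise differentiation: the difference quotient minus the candidate is the series of [g h],
    whose terms are at most a_n l_n^(j+2) |h|, and moment j + 2 is finite. *)
Lemma is_derive_trig th j t : is_derive t (1 : R) (trig a l th j) (trig a l th j.+1 t).
Proof.
pose g (h : R) := h^-1 \*: (trig_term a l th j (h + t) - trig_term a l th j t)
                  - trig_term a l th j.+1 t.
have gE h : h^-1 *: ((trig a l th j \o shift t) (h *: (1 : R)) - trig a l th j t)
          = trig a l th j.+1 t + limn (series (g h)).
  have c i u : cvgn (series (trig_term a l th i u)) by exact: trig_term_cvg.
  have cB := is_cvg_seriesB (c j (h + t)) (c j t).
  rewrite /g lim_seriesB//; last exact: is_cvg_seriesZ.
  by rewrite lim_seriesZ// lim_seriesB// /trig /= [RHS]addrC subrK /GRing.scale/= mulr1.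
have g0 : limn (series (g h)) @[h --> 0^'] --> (0 : R).
  apply: (@lim_cvg_to_0_linear _ (fun n => a n * l n ^+ j.+2) _ 1 ltr01) => //.
  move=> h /andP[h0 _] n.
  have hn0 : h != 0 by rewrite -normr_gt0.
  set u := l n * t + th + j%:R * (pi / 2).
  have -> : g h n = a n * l n ^+ j *
     (h^-1 * (cos (u + l n * h) - cos u - (l n * h) * cos (u + pi / 2))).
    transitivity (h^-1 * (trig_term a l th j (h + t) n - trig_term a l th j t n)
                  - trig_term a l th j.+1 t n) => //.
    rewrite /trig_term /u.
    have -> : l n * (h + t) + th + j%:R * (pi / 2) =
              l n * t + th + j%:R * (pi / 2) + l n * h by ring.
    have -> : l n * t + th + j.+1%:R * (pi / 2) =
              l n * t + th + j%:R * (pi / 2) + pi / 2 by rewrite -natr1; ring.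
    by rewrite exprSr; field.
  rewrite !normrM normfV (ger0_norm (a0 n)) (ger0_norm (exprn_ge0 _ (l0 n))).
  have -> : a n * l n ^+ j.+2 * `|h| = a n * l n ^+ j * (`|h|^-1 * (l n * h) ^+ 2).
    by rewrite exprMn -[h ^+ 2]real_normK ?num_real// !exprSr; field; rewrite normr_eq0.
  rewrite ler_wpM2l ?mulr_ge0 ?exprn_ge0// ler_wpM2l ?invr_ge0//.
  exact: cos_taylor1.
have cv : h^-1 *: ((trig a l th j \o shift t) (h *: (1 : R)) - trig a l th j t)
    @[h --> 0^'] --> trig a l th j.+1 t.
  under eq_fun do rewrite gE.
  have := cvgD (cvg_cst (trig a l th j.+1 t)) g0.
  by rewrite addr0; apply.
by split; [apply/cvg_ex; eexists; exact: cv | exact: cvg_lim].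
Qed.

Lemma continuous_trig th j : continuous (trig a l th j).
Proof.
move=> t; apply/differentiable_continuous/derivable1_diffP.
by case: (is_derive_trig th j t).
Qed.

End moments.
End Trig.

(** * Ridge functions *)

Section Ridge.
Context {R : realType} {d : nat} (i0 : 'I_d) (b : R).
Implicit Types (g : R -> R) (x : 'rV[R]_d) (al : multiindex d).

Definition ridge g : 'rV[R]_d -> R := fun x => g (x ord0 i0 - b).

Lemma is_derive_ridge g (dg : R -> R) : (forall t : R, is_derive t (1 : R) g (dg t)) ->
  forall x i, is_derive x (delta_mx 0 i) (ridge g)
                        (if i == i0 then ridge dg x else 0).
Proof.
move=> gdg x i.
have E h : h^-1 *: ((ridge g \o shift x) (h *: delta_mx 0 i) - ridge g x) =
   if i == i0 then h^-1 *: ((g \o shift (x ord0 i0 - b)) (h *: (1 : R)) - g (x ord0 i0 - b))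
   else 0.
  rewrite /ridge /= !mxE eqxx /= eq_sym; case: eqVneq => _ /=.
    by rewrite addrA.
  by rewrite mulr0 add0r subrr scaler0.
have cv : h^-1 *: ((ridge g \o shift x) (h *: delta_mx 0 i) - ridge g x) @[h --> 0^']
   --> if i == i0 then ridge dg x else 0.
  under eq_fun do rewrite E.
  case: eqVneq => _; last exact: cvg_cst.
  by case: (gdg (x ord0 i0 - b)) => gd gE; rewrite /ridge -gE; exact: gd.
by split; [apply/cvg_ex; eexists; exact: cv | exact: cvg_lim].
Qed.

Lemma continuous_ridge g : continuous g -> continuous (ridge g).
Proof.
move=> cg x.
apply: (@continuous_comp _ _ _ (fun x : 'rV[R]_d => x ord0 i0) (fun t => g (t - b))).
  exact: coord_continuous.
apply: (@continuous_comp _ _ _ (fun t : R => t - b) g); last exact: cg.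
by apply: cvgB; [exact: cvg_id | exact: cvg_cst].
Qed.

Context {g : nat -> R -> R}.
Hypothesis gS : forall j (t : R), is_derive t (1 : R) (g j) (g j.+1 t).
Hypothesis gc : forall j, continuous (g j).

Lemma partial_ridge i j : partial i (ridge (g j)) = if i == i0 then ridge (g j.+1) else cst 0.
Proof.
apply/funext => x; rewrite /partial (derive_val (is_derive := is_derive_ridge _ _ (gS j) x i)).
by case: ifP.
Qed.

Lemma partial_cst0 i : partial i (cst 0 : 'rV[R]_d -> R) = cst 0.
Proof. by apply/funext => x; rewrite /partial derive_cst. Qed.

Lemma partials_ridge s : partials s (ridge (g 0)) = ridge (g (size s)) \/
  partials s (ridge (g 0)) = cst 0.
Proof.
elim: s => [|i s [] /= ->]; first by left.
  by rewrite partial_ridge; case: eqVneq; [left|right].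
by rewrite partial_cst0; right.
Qed.

Lemma real_smooth_ridge U : real_smooth_on U (ridge (g 0)).
Proof.
move=> s x _; have [->|->] := partials_ridge s.
  split; first exact: continuous_ridge.
  by move=> i; case: (is_derive_ridge _ _ (gS (size s)) x i).
by split; [exact: cst_continuous | move=> i; exact: derivable_cst].
Qed.

Lemma iter_partial_ridge i j n : iter n (partial i) (ridge (g j)) =
  if (i == i0) || (n == 0)%N then ridge (g (n + j)) else cst 0.
Proof.
elim: n => [|n IH]; first by rewrite orbT.
rewrite iterS IH orbF; case: eqVneq => [->|ni] /=.
  by rewrite partial_ridge eqxx.
by case: eqVneq => [->|_]; rewrite ?partial_cst0// partial_ridge (negbTE ni).
Qed.

Lemma iter_partial_cst0 i n : iter n (partial i) (cst 0 : 'rV[R]_d -> R) = cst 0.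
Proof. by elim: n => // n; rewrite iterS => ->; rewrite partial_cst0. Qed.

(** A derivative in a coordinate other than [i0] gives zero, and zero stays zero. The induction runs
    over an arbitrary list in place of [enum 'I_d]. *)
Lemma real_mi_derive_ridge al : real_mi_derive al (ridge (g 0)) =
  if [forall i, (i == i0) || (al i == 0)%N] then ridge (g (mi_order al)) else cst 0.
Proof.
suff H s : foldr (fun i h => iter (al i) (partial i) h) (ridge (g 0)) s =
  if all (fun i => (i == i0) || (al i == 0)%N) s
  then ridge (g (\sum_(i <- s) al i)%N) else cst 0.
  rewrite /real_mi_derive H /mi_order big_enum /=; congr (if _ then _ else _).
  by apply/allP/forallP => [h i|h i _]; [apply: h; rewrite mem_enum | exact: h].
elim: s => [|i s IH] /=; first by rewrite big_nil.
rewrite IH; case: ifP => _; last by rewrite andbF iter_partial_cst0.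
by rewrite andbT iter_partial_ridge big_cons.
Qed.

Definition mi_axis j : multiindex d := [ffun i => if i == i0 then j else 0%N].

Lemma mi_order_axis j : mi_order (mi_axis j) = j.
Proof.
rewrite /mi_order (bigD1 i0)//= ffunE eqxx big1 ?addn0// => i ni.
by rewrite ffunE (negbTE ni).
Qed.

Lemma real_mi_derive_axis j : real_mi_derive (mi_axis j) (ridge (g 0)) = ridge (g j).
Proof.
rewrite real_mi_derive_ridge mi_order_axis ifT//.
by apply/forallP => i; rewrite ffunE; case: ifP => //=.
Qed.

End Ridge.

(** * From moment sequences to test functions *)

Section Transfer.
Context {R : realType} {d : nat}.

Definition dominated (u v : R^nat) := exists C, forall j, u j <= C * v j.

Definition moment_sequence (m : R^nat) := exists a l, moment_system a l m.

(** The ridge function is centred at [x0]: there cos^2 + sin^2 = 1 makes the j-th derivative along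
    [i0] have modulus exactly m_j, so the single compact set {x0} already forces domination. *)
Lemma moment_test_function (i0 : 'I_d) (m : R^nat) (x0 : 'rV[R]_d) : moment_sequence m ->
  exists f : 'rV[R]_d -> R[i],
  [/\ forall U, smooth_on U f,
      forall (W : R^nat) K, (forall j, 0 < W j) -> dominated m W ->
        (weighted_norm W K f < +oo)%E
    & forall W : R^nat, (forall j, 0 < W j) ->
        (weighted_norm W [set x0] f < +oo)%E -> dominated m W].
Proof.
move=> [a [l alm]].
have m0 j : 0 <= m j by rewrite (le_trans _ (trig_le alm 0 j 0)).
pose b := x0 ord0 i0.
pose f : 'rV[R]_d -> R[i] := fun x =>
  Complex (ridge i0 b (trig a l 0 0) x) (ridge i0 b (trig a l (- (pi / 2)) 0) x).
have dt th j (t : R) := is_derive_trig alm th j t.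
have ct th j := continuous_trig alm th j.
exists f; split.
- by move=> U; split; apply: real_smooth_ridge.
- move=> W K W0 [C mC].
  (* Real and imaginary parts are each at most m_j, so the modulus is at most sqrt 2 m_j; the factor
     2 is generous. *)
  suff : (weighted_norm W K f <= (2 * C)%:E)%E by move=> /le_lt_trans; apply; rewrite ltry.
  apply: ge_ereal_sup => _ [al [x Kx ->]]; rewrite lee_fin ler_pdivrMr//.
  rewrite -mulrA (le_trans _ (ler_wpM2l (ler0n _ 2) (mC _)))//.
  rewrite /mi_derive /= -[leRHS]ger0_norm ?mulr_ge0// -sqrtr_sqr ler_wsqrtr//.
  have H th : real_mi_derive al (ridge i0 b (trig a l th 0)) x ^+ 2 <= m (mi_order al) ^+ 2.
    rewrite (real_mi_derive_ridge _ _ (dt th)) -real_normK ?num_real//.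
    rewrite ler_sqr ?nnegrE//; case: ifP => _; first exact: trig_le.
    by rewrite normr0.
  by rewrite (le_trans (lerD (H _) (H _)))// exprMn; have := sqr_ge0 (m (mi_order al)); lra.
- move=> W W0 fW; exists (fine (weighted_norm W [set x0] f)) => j.
  have : ((m j / W j)%:E <= weighted_norm W [set x0] f)%E.
    apply: ereal_sup_ubound; exists (mi_axis i0 j), x0 => //.
    rewrite mi_order_axis /mi_derive /= !(real_mi_derive_axis _ _ (dt _)) /ridge subrr.
    rewrite !(trig_at0 alm) add0r [- _ + _]addrC cosBpihalf !exprMn -mulrDr cos2Dsin2 mulr1.
    by rewrite sqrtr_sqr ger0_norm.
  case: (weighted_norm W [set x0] f) fW => //= r _.
  by rewrite lee_fin ler_pdivrMr.
Qed.
End Transfer.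

(** * Moment sequences *)

Section Membership.
Context {R : realType} {d : nat}.

(** A single [f] serves all classes, so that a supposed equality of two classes can be read off as
    two dominations of the same [m]. *)
Lemma moment_test_function_class (i0 : 'I_d) (m : R^nat) (U : set 'rV[R]_d) :
  U !=set0 -> moment_sequence m -> exists f : 'rV[R]_d -> R[i],
  [/\ forall M, weight_sequence M ->
        (roumieu_seq U M f <->
           exists2 h, 0 < h & dominated m (fun j => h ^+ j * M j)) /\
        (beurling_seq U M f <->
           forall h, 0 < h -> dominated m (fun j => h ^+ j * M j)),
      forall om,
        (roumieu_fun U om f <->
           exists2 h, 0 < h & dominated m (fun j => expR (h^-1 * young_conj om (h * j%:R)))) /\
        (beurling_fun U om f <->
           forall h, 0 < h -> dominated m (fun j => expR (h^-1 * young_conj om (h * j%:R))))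
    & forall MM, (forall x, 0 < x -> weight_sequence (MM x)) ->
        (roumieu_fam U MM f <->
           exists x h, [/\ 0 < x, 0 < h & dominated m (fun j => h ^+ j * MM x j)]) /\
        (beurling_fam U MM f <->
           forall x h, 0 < x -> 0 < h -> dominated m (fun j => h ^+ j * MM x j))].
Proof.
move=> [x0 Ux0] mm; have [f [fS fU fL]] := moment_test_function i0 m x0 mm.
have x0U : [set x0] `<=` U by move=> _ ->.
have cx0 : compact [set x0] by exact: compact_set1.
have hM (M : R^nat) h : weight_sequence M -> 0 < h -> forall j, 0 < h ^+ j * M j.
  by move=> M0 h0 j; rewrite mulr_gt0 ?exprn_gt0 ?M0.
exists f; split.
- move=> M M0; split; split.
  + by move=> [_ /(_ _ cx0 x0U) [h h0 fh]]; exists h => //; apply: fL fh; exact: hM.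
  + by move=> [h h0 mh]; split=> // K _ _; exists h => //; apply: fU mh; exact: hM.
  + by move=> [_ fB] h h0; apply: fL (fB _ cx0 x0U _ h0); exact: hM.
  + by move=> mB; split=> // K _ _ h h0; apply: fU (mB _ h0); exact: hM.
- move=> om; split; split.
  + by move=> [_ /(_ _ cx0 x0U) [h h0 fh]]; exists h => //; apply: fL fh => j; exact: expR_gt0.
  + by move=> [h h0 mh]; split=> // K _ _; exists h => //; apply: fU mh => j; exact: expR_gt0.
  + by move=> [_ fB] h h0; apply: fL (fB _ cx0 x0U _ h0) => j; exact: expR_gt0.
  + by move=> mB; split=> // K _ _ h h0; apply: fU (mB _ h0) => j; exact: expR_gt0.
- move=> MM MM0; split; split.
  + move=> [_ /(_ _ cx0 x0U) [x [h [xp h0 fh]]]]; exists x, h; split=> //.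
    by apply: fL fh; apply: hM => //; exact: MM0.
  + move=> [x [h [xp h0 mh]]]; split=> // K _ _; exists x, h; split=> //.
    by apply: fU mh; apply: hM => //; exact: MM0.
  + move=> [_ fB] x h xp h0; apply: fL (fB _ cx0 x0U _ _ xp h0).
    by apply: hM => //; exact: MM0.
  + move=> mB; split=> // K _ _ x h xp h0; apply: fU (mB _ _ xp h0).
    by apply: hM => //; exact: MM0.
Qed.

End Membership.

(** * Gluing geometric sequences *)

Section Gluing.
Context {R : realType}.
Implicit Types (u v w b l m G : R^nat) (F : nat -> R^nat).

Lemma dominated_gt0 u v : (forall j, 0 < v j) -> dominated u v ->
  exists2 C, 0 < C & forall j, u j <= C * v j.
Proof.
move=> v0 [C uv]; exists (Num.max C 1); first by rewrite lt_max ltr01 orbT.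
by move=> j; rewrite (le_trans (uv j))// ler_pM2r// le_max lexx.
Qed.

Lemma dominated_trans u v w : (forall j, 0 < v j) ->
  dominated u v -> dominated v w -> dominated u w.
Proof.
move=> v0 /(dominated_gt0 _ _ v0) [C C0 uv] [D vw]; exists (C * D) => j.
by rewrite (le_trans (uv j))// -mulrA ler_pM2l.
Qed.

(** The finitely many indices below [K] only add the sum of their ratios to the constant. *)
Lemma dominated_tail (K : nat) (C : R) u v : (forall j, 0 < v j) ->
  (forall k, (K <= k)%N -> u k <= C * v k) -> dominated u v.
Proof.
move=> v0 uv; exists (`|C| + \sum_(i < K) `|u i / v i|) => k.
have [Kk|kK] := leqP K k.
  rewrite (le_trans (uv k Kk))// ler_pM2r// (le_trans (ler_norm C))// lerDl.
  exact: sumr_ge0.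
rewrite -ler_pdivrMr// (le_trans (ler_norm _))//.
rewrite -[leLHS]add0r lerD// (bigD1 (Ordinal kK))//= lerDl.
exact: sumr_ge0.
Qed.

Lemma not_dominated (K : nat) (C : R) u v : (forall j, 0 < v j) ->
  ~ dominated u v -> exists2 k, (K <= k)%N & C * v k < u k.
Proof.
move=> v0 nd; apply: contrapT => H; apply: nd.
apply: (dominated_tail K C _ _ v0) => k Kk.
by rewrite leNgt; apply/negP => Ck; apply: H; exists k.
Qed.

Lemma expr2_unbounded (C : R) (K : nat) : exists2 k, (K <= k)%N & C < 2 ^+ k.
Proof.
exists (K + Num.Def.archi_bound `|C|)%N; first exact: leq_addr.
rewrite (le_lt_trans (ler_norm C))// (lt_trans (archi_boundP _))//.
by rewrite -natrX ltr_nat (leq_ltn_trans (leq_addl K _))// ltn_expl.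
Qed.

(** Take m_j = sum_n 2^-n b_n l_n^j: keeping one term costs 2^n from below, and summing the weights
    costs 2 from above. *)
Lemma glue_geometric b l : (forall n, 0 <= b n) -> (forall n, 0 <= l n) ->
  (forall j, exists C, forall n, b n * l n ^+ j <= C) ->
  exists m, [/\ moment_sequence m,
    forall n j, b n * l n ^+ j <= 2 ^+ n * m j
  & forall G, (forall n j, b n * l n ^+ j <= G j) -> forall j, m j <= 2 * G j].
Proof.
move=> b0 l0 bl.
pose t j n := b n / 2 ^+ n * l n ^+ j.
have t0 j n : 0 <= t j n by rewrite /t mulr_ge0 ?divr_ge0 ?exprn_ge0.
have tle j C : (forall n, b n * l n ^+ j <= C) -> forall n, t j n <= geometric C 2^-1 n.
  by move=> H n; rewrite /t /geometric /= mulrAC exprVn ler_wpM2r// invr_ge0 exprn_ge0.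
have h1 : `|2^-1 : R| < 1 by rewrite ger0_norm ?invr_ge0//; lra.
have tc j : cvgn (series (t j)).
  have [C blC] := bl j.
  apply: (series_le_cvg _ _ (tle _ _ blC) (is_cvg_geometric_series h1)) => // n.
  by rewrite (le_trans (t0 j n)) ?tle.
exists (fun j => limn (series (t j))); split.
- exists (fun n => b n / 2 ^+ n), l; split=> // n.
  by rewrite divr_ge0// exprn_ge0.
- move=> n j; rewrite -ler_pdivrMl ?exprn_gt0// mulrC.
  have -> : b n * l n ^+ j / 2 ^+ n = t j n by rewrite /t mulrAC.
  have nd : nondecreasing_seq (series (t j)).
    by apply/nondecreasing_seqP => k; rewrite /series /= big_nat_recr//= lerDl.
  rewrite (le_trans _ (nondecreasing_cvgn_le nd (tc j) n.+1))//.
  by rewrite /series /= big_nat_recr//= lerDr sumr_ge0.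
- move=> G bG j; have gc := @is_cvg_geometric_series _ (G j) _ h1.
  rewrite (le_trans (lim_series_le (tc j) gc (tle _ _ (bG^~ j))))//.
  rewrite (cvg_lim _ (cvg_geometric_series h1))//.
  have -> : 1 - 2^-1 = 2^-1 :> R by lra.
  by rewrite invrK mulrC.
Qed.

(* Up to the factor 2, the geometric sequences lying below F reach F' at every
   index from K on; this stands in for log-convexity. *)
Definition touches_from (K : nat) (F F' : R^nat) := forall k, (K <= k)%N ->
  exists a x : R, [/\ 0 <= a, 0 <= x, forall j, a * x ^+ j <= F j & F' k <= 2 * (a * x ^+ k)].

(** One piece is glued for each index k, touching F' at k itself, so its weight 2^-k costs just the
    geometric factor 2^k. Indices below [K] get the zero piece. *)
Lemma moment_between (K : nat) (F F' : R^nat) : (forall j, 0 < F j) ->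
  touches_from K F F' -> exists m, [/\ moment_sequence m, dominated m F
  & forall G, (forall j, 0 < G j) -> dominated m G ->
      dominated F' (fun j => 2 ^+ j * G j)].
Proof.
move=> F0 sp.
have /choice [a] k : exists p : R * R, [/\ 0 <= p.1, 0 <= p.2,
    forall j, p.1 * p.2 ^+ j <= F j & (K <= k)%N -> F' k <= 2 * (p.1 * p.2 ^+ k)].
  have [Kk|kK] := leqP K k.
    by have [a [l [a0 l0 aF Fa]]] := sp k Kk; exists (a, l); split.
  by exists (0, 0); split=> //= j; rewrite mul0r ltW.
move=> aP.
have [] := glue_geometric (fun k => (a k).1) (fun k => (a k).2).
- by move=> k; case: (aP k).
- by move=> k; case: (aP k).
- by move=> j; exists (F j) => k; case: (aP k).
move=> m [mm ml mu]; exists m; split=> //.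
  by exists 2; apply: mu => k; case: (aP k).
move=> G G0 /(dominated_gt0 _ _ G0) [C C0 mG].
apply: (dominated_tail K (2 * C)) => [j|k Kk]; first by rewrite mulr_gt0 ?exprn_gt0.
have [_ _ _ /(_ Kk) H] := aP k; rewrite (le_trans H)// -mulrA ler_pM2l//.
rewrite (le_trans (ml k k))// mulrCA ler_pM2l ?exprn_gt0//.
Qed.

(** A gliding hump replaces a closed graph argument. If no F_n is dominated by G, geometric pieces
    below F_n that overshoot 4^n G somewhere can be glued; the result is dominated by every F_n but
    not by G. *)
Lemma decreasing_family_dominated F G :
  (forall n j, 0 < F n j) -> (forall j, 0 < G j) ->
  (forall n k j, (n <= k)%N -> F k j <= F n j) ->
  (forall n x, 0 <= x -> dominated (fun j => x ^+ j) (F n)) ->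
  (forall n, exists K, touches_from K (F n) (F n.+1)) ->
  (forall m, moment_sequence m -> (forall n, dominated m (F n)) -> dominated m G) ->
  exists n, dominated (F n) G.
Proof.
move=> F0 G0 Fdec Fabs Fsp H; apply: contrapT => nFG.
(* The factor 4^n survives the gluing weight 2^-n and leaves an unbounded ratio 2^n. *)
have /choice [p] n : exists p : R * R * nat, [/\ 0 <= p.1.1, 0 <= p.1.2,
    forall j, p.1.1 * p.1.2 ^+ j <= F n j
  & 4 ^+ n * G p.2 < 2 * (p.1.1 * p.1.2 ^+ p.2)].
  have [K sp] := Fsp n.
  have [|k Kk Gk] := not_dominated K (4 ^+ n) (F n.+1) _ G0.
    by move=> h; apply: nFG; exists n.+1.
  have [a [l [a0 l0 aF Fa]]] := sp k Kk.
  by exists (a, l, k); split=> //=; exact: lt_le_trans Fa.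
move=> pP.
pose b n := (p n).1.1; pose l n := (p n).1.2; pose k n := (p n).2.
have b0 n : 0 <= b n by case: (pP n).
have l0 n : 0 <= l n by case: (pP n).
have bF n j : b n * l n ^+ j <= F n j by case: (pP n).
have Gk n : 4 ^+ n * G (k n) < 2 * (b n * l n ^+ k n) by case: (pP n).
have [|m [mm ml mu]] := glue_geometric b l b0 l0.
  by move=> j; exists (F 0%N j) => n; rewrite (le_trans (bF n j))// Fdec.
have mF n : dominated m (F n).
  (* Pieces with i >= n lie below F_n by monotonicity; the finitely many earlier ones are single
     geometric sequences, absorbed by [Fabs]. *)
  have /choice [C CP] i : exists C, 0 <= C /\ forall j, b i * l i ^+ j <= C * F n j.
    have [C C0 lC] := dominated_gt0 _ _ (F0 n) (Fabs n _ (l0 i)).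
    exists (b i * C); split; first by rewrite mulr_ge0// ltW.
    by move=> j; rewrite -mulrA ler_wpM2l.
  pose S := 1 + \sum_(i < n) C i.
  have S1 : 1 <= S by rewrite lerDl sumr_ge0// => i _; case: (CP i).
  exists (2 * S) => j; rewrite -mulrA; apply: (mu (fun j => S * F n j)) => i {}j.
  have [ni|lin] := leqP n i.
    by rewrite (le_trans (bF i j))// (le_trans (Fdec n i j ni))// ler_peMl// ltW.
  have [_ /(_ j)/le_trans -> //] := CP i.
  rewrite ler_pM2r// /S (bigD1 (Ordinal lin))//= addrCA lerDl addr_ge0// sumr_ge0// => q _.
  by case: (CP q).
have [C C0 mG] := dominated_gt0 _ _ G0 (H m mm mF).
have bound n : 2 ^+ n < 2 * C.
  have := lt_le_trans (Gk n) (ler_wpM2l (ler0n _ 2) (ml n (k n))).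
  have := ler_wpM2l (exprn_ge0 n (ler0n R 2)) (mG (k n)).
  have -> : 4 = 2 * 2 :> R by lra.
  rewrite exprMn => h1 h2.
  have : 2 ^+ n * 2 ^+ n * G (k n) < 2 ^+ n * (2 * C) * G (k n) by nra.
  by rewrite ltr_pM2r// ltr_pM2l// exprn_gt0.
have [i _] := expr2_unbounded (2 * C) 0.
by apply/negP; rewrite -leNgt ltW.
Qed.

(** Gliding hump for an increasing family: the n-th piece lies below G and overshoots F_n by about
    4^n at one index; since F_i >= F_n for i >= n, all later pieces also witness against F_n. *)
Lemma moment_escaping F G :
  (forall n j, 0 < F n j) -> (forall j, 0 < G j) ->
  (forall n k j, (n <= k)%N -> F n j <= F k j) ->
  (forall n, ~ dominated (F n.+1) (F n)) ->
  (forall n, exists K, touches_from K (F n.+1) (F n)) ->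
  (forall n, dominated (F n) G) ->
  exists m, [/\ moment_sequence m, dominated m G & forall n, ~ dominated m (F n)].
Proof.
move=> F0 G0 Finc Fstr Fsp FG.
have /choice [p] n : exists p : R * R * nat, [/\ 0 <= p.1.1, 0 <= p.1.2,
    forall j, p.1.1 * p.1.2 ^+ j <= G j
  & 4 ^+ n * F n p.2 < 2 * (p.1.1 * p.1.2 ^+ p.2)].
  (* Two levels up: F_(n+1) escapes F_n, and touching F_(n+1) needs room up to F_(n+2), which is at
     most C G. Hence the division by [C] below. *)
  have [C C0 FC] := dominated_gt0 _ _ G0 (FG n.+2).
  have [K sp] := Fsp n.+1.
  have [k Kk Gk] := not_dominated K (C * 4 ^+ n) _ _ (F0 n) (Fstr n).
  have [a [l [a0 l0 aF Fa]]] := sp k Kk.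
  exists (a / C, l, k); split=> //=; first by rewrite divr_ge0// ltW.
    by move=> j; rewrite mulrAC ler_pdivrMr// mulrC (mulrC (G j)) mulrC (le_trans (aF j)).
  rewrite -(ltr_pM2l C0) [ltLHS]mulrA (lt_le_trans Gk)// (le_trans Fa)//.
  by rewrite le_eqVlt; apply/orP; left; apply/eqP; field; rewrite gt_eqF.
move=> pP.
pose b n := (p n).1.1; pose l n := (p n).1.2; pose k n := (p n).2.
have [|||m [mm ml mu]] := glue_geometric b l.
- by move=> n; case: (pP n).
- by move=> n; case: (pP n).
- by move=> j; exists (G j) => n; case: (pP n).
exists m; split=> //; first by exists 2; apply: mu => n; case: (pP n).
move=> n /(dominated_gt0 _ _ (F0 n)) [C C0 mF].
have bound i : (n <= i)%N -> 2 ^+ i < 2 * C.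
  move=> ni.
  have Gk : 4 ^+ i * F i (k i) < 2 * (b i * l i ^+ k i) by case: (pP i).
  have := lt_le_trans Gk (ler_wpM2l (ler0n _ 2) (ml i (k i))).
  have := ler_wpM2l (exprn_ge0 i (ler0n R 2)) (mF (k i)).
  have Fi := Finc n i (k i) ni.
  have -> : 4 = 2 * 2 :> R by lra.
  rewrite exprMn => h1 h2.
  have h3 : C * F n (k i) <= C * F i (k i) by rewrite ler_pM2l.
  have h4 := ler_wpM2l (exprn_ge0 i (ler0n R 2)) h3.
  have : 2 ^+ i * 2 ^+ i * F i (k i) < 2 ^+ i * (2 * C) * F i (k i) by nra.
  by rewrite ltr_pM2r// ltr_pM2l// exprn_gt0.
have [i ni] := expr2_unbounded (2 * C) n.
by apply/negP; rewrite -leNgt ltW// bound.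
Qed.

End Gluing.

(** * The sequences M^(c,tau,sigma) *)

Section Sequences.
Context {R : realType} {tau sigma : R} (tau0 : 0 < tau) (sigma1 : 1 < sigma).
Implicit Types (c H : R) (j k : nat).

Let sigma0 : 0 < sigma. Proof. exact: lt_trans sigma1. Qed.

(** Convexity of x^sigma, obtained from Young's inequality for x and y^(sigma-1) with exponents
    sigma and sigma / (sigma - 1). *)
Lemma powR_tangent (x y : R) : 0 <= x -> 0 <= y ->
  y `^ sigma + sigma * y `^ (sigma - 1) * (x - y) <= x `^ sigma.
Proof.
move=> x0 y0.
have s1 : 0 < sigma - 1 by rewrite subr_gt0.
have := @conjugate_powR _ x (y `^ (sigma - 1)) sigma (sigma / (sigma - 1)) x0 (powR_ge0 _ _) sigma0.
rewrite -powRrM.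
have -> : (sigma - 1) * (sigma / (sigma - 1)) = sigma by field; rewrite gt_eqF.
move=> /(_ (divr_gt0 sigma0 s1)).
have -> : sigma^-1 + (sigma / (sigma - 1))^-1 = 1 by field; rewrite !gt_eqF.
move=> /(_ erefl); rewrite invf_div => h.
have := ler_wpM2l (ltW sigma0) h; rewrite mulrDr.
have -> : sigma * (x `^ sigma / sigma) = x `^ sigma by field; rewrite gt_eqF.
have -> : sigma * (y `^ sigma * ((sigma - 1) / sigma)) = (sigma - 1) * y `^ sigma.
  by field; rewrite gt_eqF.
have := mulr_powRB1 y0 sigma0; nra.
Qed.

Lemma powR_nat_ge j : j%:R <= (j%:R : R) `^ sigma.
Proof.
case: j => [|j]; first by rewrite powR_ge0.
by rewrite -[leLHS]powRr1//; apply: ler_powR; [rewrite ler1n | exact: ltW].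
Qed.

(** The right side is (b^(j^(sigma-1)))^j, whose base exceeds H as soon as j^(sigma-1) >= t, where
    b^t = e^H. *)
Lemma expr_dominated (b H : R) : 1 < b -> 0 <= H ->
  dominated (fun j => H ^+ j) (fun j => b `^ (j%:R `^ sigma)).
Proof.
move=> b1 H0.
have b0 : 0 < b by exact: lt_trans b1.
have lnb : 0 < ln b by rewrite ln_gt0.
have s1 : 0 < sigma - 1 by rewrite subr_gt0.
pose t := H / ln b.
have t0 : 0 <= t by rewrite divr_ge0// ltW.
pose K := Num.Def.archi_bound (t `^ (sigma - 1)^-1).
apply: (@dominated_tail _ K 1) => [j|j Kj]; first exact: powR_gt0.
have Kt : t <= j%:R `^ (sigma - 1).
  have -> : t = (t `^ (sigma - 1)^-1) `^ (sigma - 1).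
    by rewrite -powRrM mulVf ?gt_eqF// powRr1.
  rewrite ge0_ler_powR ?nnegrE ?powR_ge0 ?(ltW s1)//.
  by rewrite ltW// (lt_le_trans (archi_boundP _)) ?powR_ge0// ler_nat.
rewrite mul1r -(mulr_powRB1 (ler0n _ j) sigma0) mulrC powRrM powR_mulrn ?powR_ge0//.
rewrite lerXn2r ?nnegrE ?powR_ge0//.
rewrite (@le_trans _ _ (b `^ t))// ?ler_powR ?(ltW b1)//.
rewrite /powR gt_eqF// /t divfK ?gt_eqF//.
by rewrite (le_trans _ (expR_ge1Dx _))// lerDr.
Qed.

Let powR0s : 0%:R `^ sigma = 0 :> R. Proof. by rewrite powR0 ?gt_eqF. Qed.

Local Notation N := (Mts tau sigma).

Lemma Mts_gt0 c j : 0 < c -> 0 < N c j.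
Proof.
move=> c0; apply: mulr_gt0; first exact: powR_gt0.
case: j => [|j]; last by rewrite powR_gt0.
by rewrite powR0s mulr0 powRr0.
Qed.

Lemma Mts0 c : N c 0 = 1.
Proof. by rewrite /Mts powR0s mulr0 !powRr0 mulr1. Qed.

Lemma MtsM b c j : 0 <= b -> 0 <= c -> N (b * c) j = b `^ (j%:R `^ sigma) * N c j.
Proof. by move=> b0 c0; rewrite /Mts powRM// mulrA. Qed.

Lemma ler_Mts c c' j : 0 < c -> c <= c' -> N c j <= N c' j.
Proof.
move=> c0 cc'; have c'0 := lt_le_trans c0 cc'.
by rewrite /Mts ler_wpM2r ?powR_ge0// ge0_ler_powR ?powR_ge0 ?nnegrE ?(ltW c0) ?(ltW c'0).
Qed.

Lemma Mts_expR c j : 0 < c -> (0 < j)%N ->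
  N c j = expR (j%:R `^ sigma * (ln c + tau * ln j%:R)).
Proof.
move=> c0 j0; rewrite /Mts [c `^ _]/powR [in LHS]gt_eqF//.
rewrite [j%:R `^ (tau * _)]/powR [X in if X then _ else _]gt_eqF ?ltr0n//.
by rewrite -expRD; congr expR; ring.
Qed.

(** The quotient of the two sequences is (c' / c)^(j^sigma), which beats every H^j. Factors h^j in
    the norms thus cost only an arbitrarily small change of [c]. *)
Lemma Mts_absorb c c' H : 0 < c -> c < c' -> 0 <= H ->
  dominated (fun j => H ^+ j * N c j) (N c').
Proof.
move=> c0 cc' H0.
have [|C HC] := @expr_dominated (c' / c) H _ H0; first by rewrite ltr_pdivlMr// mul1r.
exists C => j; have -> : c' = c' / c * c by rewrite divfK ?gt_eqF.
have c'0 := lt_trans c0 cc'.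
by rewrite MtsM ?divr_ge0 ?(ltW c0) ?(ltW c'0)// mulrA ler_pM2r ?Mts_gt0 ?HC//.
Qed.

(** As [c] may be below 1, the comparison passes through 2^(j^sigma), which lies below M^(c) once ln
    c + tau ln j >= ln 2. *)
Lemma expr_dominated_Mts c x : 0 < c -> 0 <= x -> dominated (fun j => x ^+ j) (N c).
Proof.
move=> c0 x0.
have b1 : 1 < 2 :> R by rewrite ltr1n.
have p0 j : 0 < (2 : R) `^ (j%:R `^ sigma) by exact: powR_gt0.
apply: (dominated_trans _ _ _ p0 (expr_dominated _ _ b1 x0)).
apply: (@dominated_tail _ (Num.Def.archi_bound (expR ((ln 2 - ln c) / tau))).+1 1).
  by move=> j; exact: Mts_gt0.
move=> k Kk; have k0 : (0 < k)%N by apply: leq_trans Kk.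
rewrite mul1r Mts_expR// /powR gt_eqF// ler_expR ler_wpM2l ?expR_ge0//.
  by case: ifP => _.
have : (ln 2 - ln c) / tau <= ln k%:R.
  rewrite -[leLHS]expRK ler_ln ?posrE ?expR_gt0 ?ltr0n//.
  rewrite ltW// (lt_le_trans (archi_boundP (expR_ge0 _)))// ler_nat.
  exact: ltnW.
by rewrite ler_pdivrMr// mulrC; lra.
Qed.

(** Otherwise [Mts_absorb] with 2 H in place of H would bound 2^k. *)
Lemma Mts_not_absorb c c' H : 0 < c -> c < c' -> 0 < H ->
  ~ dominated (N c') (fun j => H ^+ j * N c j).
Proof.
move=> c0 cc' H0 /dominated_gt0 [|C C0 NC].
  by move=> j; rewrite mulr_gt0 ?exprn_gt0 ?Mts_gt0.
have c'0 := lt_trans c0 cc'.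
have /dominated_gt0 [|D D0 ND] := Mts_absorb _ _ (2 * H) c0 cc' (mulr_ge0 (ler0n _ 2) (ltW H0)).
  by move=> j; exact: Mts_gt0.
have [k _] := expr2_unbounded (D * C) 0.
apply/negP; rewrite -leNgt.
have := le_trans (ND k) (ler_wpM2l (ltW D0) (NC k)).
rewrite exprMn -mulrA mulrA [X in _ <= X]mulrA.
by rewrite -[2 ^+ k * H ^+ k * _]mulrA ler_pM2r// mulr_gt0 ?exprn_gt0 ?Mts_gt0.
Qed.

(** Freeze the logarithm at k, with L = ln c + tau ln k, and replace j^sigma by its tangent at k:
    exp of the result is geometric in j. The factor exp(- tau k^sigma) pays for the freezing and
    turns [c] into c e^(-tau) at j = k. Large k makes L >= 0, so the tangent inequality may be
    multiplied by L. *)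
Lemma Mts_touches c : 0 < c -> exists K, touches_from K (N c) (N (c * expR (- tau))).
Proof.
move=> c0.
exists (Num.Def.archi_bound (expR (- ln c / tau))).+1 => k Kk.
have k0 : (0 < k)%N by apply: leq_trans Kk.
have kr0 : 0 < k%:R :> R by rewrite ltr0n.
pose L := ln c + tau * ln k%:R.
have L0 : 0 <= L.
  have : - ln c / tau <= ln k%:R.
    rewrite -[leLHS]expRK ler_ln ?posrE ?expR_gt0//.
    rewrite ltW// (lt_le_trans (archi_boundP (expR_ge0 _)))// ler_nat.
    exact: ltnW.
  by rewrite ler_pdivrMr// /L mulrC; lra.
pose u := (k%:R : R) `^ sigma.
pose s := sigma * (k%:R : R) `^ (sigma - 1).
have u0 : 0 <= u by exact: powR_ge0.
have al j : expR (L * (u - s * k%:R) - tau * u) * expR (L * s) ^+ j =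
            expR (L * (u + s * (j%:R - k%:R)) - tau * u).
  by rewrite -expRM_natl -expRD; congr expR; ring.
exists (expR (L * (u - s * k%:R) - tau * u)), (expR (L * s)).
split; rewrite ?expR_ge0//.
- case=> [|j].
    rewrite al Mts0 expR_le1 sub0r.
    have := mulr_powRB1 (ltW kr0) sigma0; rewrite -/u /s => E.
    have -> : u + sigma * k%:R `^ (sigma - 1) * - k%:R = (1 - sigma) * u.
      by rewrite -E; ring.
    have s1 : 0 <= sigma - 1 by rewrite subr_ge0 ltW.
    by have := mulr_ge0 s1 (mulr_ge0 L0 u0); have := mulr_ge0 (ltW tau0) u0; lra.
  rewrite al Mts_expR// ler_expR.
  have B := powR_tangent j.+1%:R k%:R (ler0n _ _) (ltW kr0).
  have v0 : 0 < (j.+1%:R : R) `^ sigma by rewrite powR_gt0.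
  set v := j.+1%:R `^ sigma in B v0 *.
  (* Cost of freezing the logarithm: with d = ln k - ln (j+1) > 0, u = v e^(sigma d) >= v (1 + sigma
     d) >= v d. *)
  have le1 : v * (ln k%:R - ln j.+1%:R) <= u.
    have [d0|d0] := leP (ln k%:R) (ln j.+1%:R : R).
      by rewrite (le_trans _ u0)// mulr_ge0_le0 ?(ltW v0)// subr_le0.
    have -> : u = v * expR (sigma * (ln k%:R - ln j.+1%:R)).
      by rewrite /u /v /powR !gt_eqF ?ltr0n// -expRD; congr expR; ring.
    rewrite ler_pM2l// (le_trans _ (expR_ge1Dx _))//.
    have s1 : 0 <= sigma - 1 by rewrite subr_ge0 ltW.
    have d1 : 0 <= ln k%:R - ln j.+1%:R :> R by rewrite subr_ge0 ltW.
    by have := mulr_ge0 s1 d1; lra.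
  have := ler_wpM2l L0 B; rewrite -/u -/s => h1.
  have := ler_wpM2l (ltW tau0) le1 => h2.
  rewrite /L in h1 *; nra.
- rewrite al Mts_expR// ?mulr_gt0 ?expR_gt0//.
  rewrite lnM ?posrE ?expR_gt0// expRK subrr mulr0 addr0 -/u.
  have -> : u * (ln c - tau + tau * ln k%:R) = L * u - tau * u by rewrite /L; ring.
  have := expR_gt0 (L * u - tau * u); lra.
Qed.

(* [M_(2j)] carries the exponent [2 `^ sigma > 2] where [M_j ^ 2] only has [2]. *)
Lemma Mts_double c c' : 0 < c -> 0 < c' ->
  ~ dominated (fun j => N c (2 * j)) (fun j => N c' j ^+ 2).
Proof.
move=> c0 c'0 /dominated_gt0 [|C C0 NC].
  by move=> j; rewrite exprn_gt0// Mts_gt0.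
have p2 : 2 < 2 `^ sigma :> R.
  rewrite -[ltLHS](lnK (x := 2)) ?posrE// /powR gt_eqF// ltr_expR.
  by rewrite ltr_pMl// ln_gt0// ltr1n.
pose del : R := 2 `^ sigma - 2.
have del0 : 0 < del by rewrite subr_gt0.
(* The difference of the two exponents, divided by j^sigma, is del tau ln j + Q. The choice of [x]
   makes this at least 1 and also gives ln C < j <= j^sigma. *)
pose Q : R := 2 `^ sigma * ln c + 2 `^ sigma * tau * ln 2 - 2 * ln c'.
pose x := expR ((1 - Q) / (del * tau)) + `|ln C|.
have x0 : 0 <= x by rewrite addr_ge0 ?expR_ge0.
pose j := (Num.Def.archi_bound x).
have xj : x < j%:R by exact: archi_boundP.
have j0 : (0 < j)%N by rewrite -(ltr0n R) (le_lt_trans x0).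
have dt0 : 0 < del * tau by rewrite mulr_gt0.
have h1 : 1 <= del * tau * ln j%:R + Q.
  have : (1 - Q) / (del * tau) <= ln j%:R.
    rewrite -[leLHS]expRK ler_ln ?posrE ?expR_gt0 ?ltr0n//.
    by rewrite ltW// (le_lt_trans _ xj)// lerDl.
  by rewrite ler_pdivrMr// mulrC; lra.
have h2 : ln C < j%:R.
  by rewrite (le_lt_trans (ler_norm _))// (le_lt_trans _ xj)// lerDr expR_ge0.
have := NC j; rewrite !Mts_expR ?muln_gt0// natrM powRM// lnM ?posrE ?ltr0n//.
rewrite -expRM_natl -{1}(lnK (x := C)) ?posrE// -expRD ler_expR.
have := powR_nat_ge j; set v := _ `^ sigma; move=> jv.
apply/negP; rewrite -ltNge.
have := ler_wpM2l (le_trans (ler0n _ _) jv) h1.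
rewrite /Q /del; nra.
Qed.

End Sequences.

(** * The weights exp (phi^*(h j) / h) *)

Section OmegaWeights.
Context {R : realType} {om : R -> R} (omW : weight_function om).
Implicit Types (h s t x : R) (j : nat).

Let phi_ge0 t : 0 <= phi om t. Proof. by rewrite (wf_ge0 omW) ?expR_ge0. Qed.

(** By log t = o(omega(t)), (|s| + 1) t <= phi(t) once e^t > A; for the other t, t <= e^t <= A. *)
Lemma young_conj_bounded s : exists B, forall t, 0 <= t -> s * t - phi om t <= B.
Proof.
have e0 : 0 < (`|s| + 1)^-1 by rewrite invr_gt0 ltr_wpDl.
have [A [_ HA]] := (eqoP _ _ _).1 (wf_log omW) _ e0.
exists (`|s| * `|A|) => t t0.
have st : s * t <= `|s| * t by rewrite ler_wpM2r// ler_norm.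
have [At|tA] := ltP A (expR t).
  have := HA _ At; rewrite /= expRK (ger0_norm t0) (ger0_norm (phi_ge0 t)).
  rewrite mulrC ler_pdivlMr ?ltr_wpDl// => h1.
  have := phi_ge0 t; have := mulr_ge0 (normr_ge0 s) (normr_ge0 A).
  rewrite /phi in h1 *; nra.
have tA' : t <= `|A|.
  rewrite (le_trans _ (ler_norm A))// (le_trans _ tA)//.
  by rewrite (le_trans _ (expR_ge1Dx t))// lerDr.
have := ler_wpM2l (normr_ge0 s) tA'; have := phi_ge0 t; lra.
Qed.

Lemma young_conj_ge s t : 0 <= t -> s * t - phi om t <= young_conj om s.
Proof.
move=> t0; apply: ub_le_sup; last by exists t => //; rewrite /= in_itv /= andbT.
have [B HB] := young_conj_bounded s.
by exists B => y [u /=]; rewrite in_itv /= andbT => u0 <-; exact: HB.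
Qed.

Lemma young_conj_near s (e : R) : 0 < e ->
  exists2 t, 0 <= t & young_conj om s - e < s * t - phi om t.
Proof.
move=> e0; have [B HB] := young_conj_bounded s.
have [|y [t /=]] := @sup_adherent _ [set s * t - phi om t | t in `[0, +oo[] e e0.
  split; first by exists (s * 0 - phi om 0), 0 => //=; rewrite in_itv /= lexx.
  by exists B => y [u /=]; rewrite in_itv /= andbT => u0 <-; exact: HB.
by rewrite in_itv /= andbT => t0 <- h; exists t.
Qed.

(** The supremum over t >= 0 of the geometric sequences exp(- phi(t) / h) (e^t)^j. *)
Definition omega_weight h j : R := expR (h^-1 * young_conj om (h * j%:R)).

Lemma omega_weight_gt0 h j : 0 < omega_weight h j. Proof. exact: expR_gt0. Qed.

Lemma expR_omega_geometric h t j : 0 < h ->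
  expR (- (h^-1 * phi om t)) * expR t ^+ j = expR (h^-1 * (h * j%:R * t - phi om t)).
Proof.
move=> h0; rewrite -expRM_natl -expRD; congr expR; field.
by rewrite gt_eqF.
Qed.

Lemma omega_weight_ge h t j : 0 < h -> 0 <= t ->
  expR (- (h^-1 * phi om t)) * expR t ^+ j <= omega_weight h j.
Proof.
move=> h0 t0; rewrite expR_omega_geometric// ler_expR ler_pM2l ?invr_gt0//.
exact: young_conj_ge.
Qed.

Lemma omega_weight_touches h : 0 < h -> touches_from 0 (omega_weight h) (omega_weight h).
Proof.
move=> h0 k _.
(* An error h ln 2 in the conjugate becomes the factor 2 after division by h and exponentiation. *)
have e0 : 0 < h * ln 2 by rewrite mulr_gt0// ln_gt0// ltr1n.
have [t t0 ht] := young_conj_near (h * k%:R) _ e0.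
exists (expR (- (h^-1 * phi om t))), (expR t); split; rewrite ?expR_ge0//.
  by move=> j; exact: omega_weight_ge.
have e2 : 2 = expR (h^-1 * (h * ln 2)) :> R by rewrite mulKf ?gt_eqF// lnK ?posrE.
rewrite expR_omega_geometric// [X in X * _]e2 -expRD ler_expR.
by rewrite -mulrDr ler_pM2l ?invr_gt0//; lra.
Qed.

(** The logarithm is the supremum of j t - phi(t) / h, which grows with h because phi >= 0. *)
Lemma omega_weight_le h h' j : 0 < h -> h <= h' -> omega_weight h j <= omega_weight h' j.
Proof.
move=> h0 hh'; have h'0 := lt_le_trans h0 hh'.
rewrite ler_expR ler_pdivrMl//; apply: ge_sup.
  by exists (h * j%:R * 0 - phi om 0), 0 => //=; rewrite in_itv /= lexx.
move=> y [t /=]; rewrite in_itv /= andbT => t0 <-.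
have := young_conj_ge (h' * j%:R) _ t0.
have q0 : 0 <= h / h' by rewrite divr_ge0 ?ltW.
have q1 : h / h' <= 1 by rewrite ler_pdivrMr// mul1r.
move=> /(ler_wpM2l q0); rewrite -[leRHS]mulrA; apply: le_trans.
have -> : h / h' * (h' * j%:R * t - phi om t) = h * j%:R * t - h / h' * phi om t.
  by field; rewrite gt_eqF.
by rewrite lerD2l lerN2 ler_piMl.
Qed.

Lemma omega_weight_absorb h x : 0 < h -> 0 <= x ->
  dominated (fun j => x ^+ j) (omega_weight h).
Proof.
(* The maximum with 1 makes t = ln y an admissible point of the supremum. *)
move=> h0 x0; pose y := Num.max x 1.
have y1 : 1 <= y by rewrite le_max lexx orbT.
have y0 : 0 < y by exact: lt_le_trans y1.
have ly : 0 <= ln y by exact: ln_ge0.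
exists (expR (h^-1 * phi om (ln y))) => j.
rewrite (@le_trans _ _ (y ^+ j))//.
  by rewrite lerXn2r ?nnegrE ?(ltW y0)// le_max lexx.
have := omega_weight_ge h (ln y) j h0 ly.
by rewrite lnK ?posrE// expRN ler_pdivrMl ?expR_gt0.
Qed.

Lemma omega_weight_double h j : 0 < h ->
  omega_weight h (2 * j) = omega_weight (2 * h) j ^+ 2.
Proof.
move=> h0; rewrite /omega_weight -expRM_natl natrM; congr expR.
have -> : h * (2 * j%:R) = 2 * h * j%:R by ring.
by field; rewrite gt_eqF.
Qed.

End OmegaWeights.

(** * Comparison of the classes *)

Section Domination.
Context {R : realType}.
Implicit Types (u v : R^nat) (c h x : R).

Lemma dominated_expr h u v : 0 <= h -> dominated u v ->
  dominated (fun j => h ^+ j * u j) (fun j => h ^+ j * v j).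
Proof.
move=> h0 [C uv]; exists C => j.
by rewrite mulrCA ler_wpM2l ?exprn_ge0.
Qed.

Lemma expr1_weight v : (fun j => 1 ^+ j * v j) = v.
Proof. by apply/funext => j; rewrite expr1n mul1r. Qed.

Context {tau sigma : R} (tau0 : 0 < tau) (sigma1 : 1 < sigma).
Local Notation N := (Mts tau sigma).

Lemma Mts_absorb_inv c c' h : 0 < c -> c < c' -> 0 < h ->
  dominated (N c) (fun j => h ^+ j * N c' j).
Proof.
move=> c0 cc' h0.
have hi0 : 0 <= h^-1 by rewrite invr_ge0 ltW.
have E : (fun j => h ^+ j * (h^-1 ^+ j * N c j)) = N c.
  by apply/funext => j; rewrite mulrA -exprMn mulfV ?gt_eqF// expr1n mul1r.
rewrite -E; apply: dominated_expr; first exact: ltW.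
exact: Mts_absorb.
Qed.

Lemma expR_multiple_gt x : exists n : nat, x < expR (n%:R * tau).
Proof.
exists (Num.Def.archi_bound (`|x| / tau)).
rewrite (le_lt_trans (ler_norm x))// (@lt_le_trans _ _ (1 + `|x|))//.
  by rewrite ltrDr.
rewrite (le_trans _ (expR_ge1Dx _))// lerD2l -ler_pdivrMr// ltW//.
by rewrite archi_boundP// divr_ge0// ltW.
Qed.

(** Parameters e^(n tau) and e^(-n tau) are spaced so that one step is exactly the loss in
    [Mts_touches]. *)
Lemma Mts_touches_step n :
  (exists K, touches_from K (N (expR (n.+1%:R * tau))) (N (expR (n%:R * tau)))) /\
  (exists K, touches_from K (N (expR (- (n%:R * tau)))) (N (expR (- (n.+1%:R * tau))))).
Proof.
split.
  have -> : n%:R * tau = n.+1%:R * tau + - tau by rewrite -natr1; ring.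
  by rewrite expRD; apply: Mts_touches; rewrite ?expR_gt0.
have -> : - (n.+1%:R * tau) = - (n%:R * tau) + - tau by rewrite -natr1; ring.
by rewrite expRD; apply: Mts_touches; rewrite ?expR_gt0.
Qed.

Lemma dominated_Mts_inf m :
  (forall n, dominated m (N (expR (- (n%:R * tau))))) ->
  forall x h, 0 < x -> 0 < h -> dominated m (fun j => h ^+ j * N x j).
Proof.
move=> mN x h x0 h0; have [n xn] := expR_multiple_gt x^-1.
have nx : expR (- (n%:R * tau)) < x by rewrite expRN invf_plt ?posrE ?expR_gt0.
apply: dominated_trans (mN n) (Mts_absorb_inv _ _ _ (expR_gt0 _) nx h0).
by move=> j; rewrite Mts_gt0 ?expR_gt0.
Qed.

(* [W_(2j) = (W'_j)^2] for the weight [W'] with doubled parameter, so squeezing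
   the [M^(c)] between two such weights would contradict [Mts_double]. *)
Lemma omega_weight_not_squeezed (om : R -> R) h c c' : 0 < h -> 0 < c -> 0 < c' ->
  dominated (N c) (fun j => 2 ^+ j * omega_weight (om := om) h j) ->
  dominated (omega_weight (om := om) (2 * h)) (N c') -> False.
Proof.
move=> h0 c0 c'0 /dominated_gt0 [j|C C0 NW WN].
  by rewrite mulr_gt0 ?exprn_gt0 ?omega_weight_gt0.
have c'2 : c' < 2 * c' by lra.
have c20 : 0 < 2 * c' by rewrite mulr_gt0.
have [||D D0 WD] := @dominated_gt0 _ (fun j => 2 ^+ j * omega_weight (om := om) (2 * h) j) (N (2 * c')).
- by move=> j; exact: Mts_gt0.
- apply: dominated_trans (dominated_expr _ _ _ (ler0n _ 2) WN) _.
    by move=> j; rewrite mulr_gt0 ?exprn_gt0 ?Mts_gt0.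
  exact: Mts_absorb.
(* With W^(h) the omega weight: M^(c)_(2j) <= C 4^j W^(h)_(2j) = C (2^j W^(2h)_j)^2 <= C D^2
   (M^(2c')_j)^2. *)
apply: (Mts_double tau0 sigma1 _ _ c0 c20); exists (C * D ^+ 2) => j.
rewrite (le_trans (NW _))// -mulrA ler_pM2l// omega_weight_double// -exprMn.
rewrite mulnC exprM -exprMn lerXn2r ?nnegrE//.
  by rewrite mulr_ge0 ?exprn_ge0// ltW// omega_weight_gt0.
by rewrite mulr_ge0// ltW// Mts_gt0.
Qed.

End Domination.

Theorem mainTheorem6 (R : realType) (d : nat) (d_gt0 : (0 < d)%N)
    (tau sigma : R) (tau_gt0 : 0 < tau) (sigma_gt1 : 1 < sigma)
    (U : set 'rV[R]_d) (U_neq0 : U !=set0) (U_open : open U) :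
  [/\ forall M : nat -> R, weight_sequence M ->
        roumieu_fam U (Mts tau sigma) <> roumieu_seq U M,
      forall omega : R -> R, weight_function omega ->
        roumieu_fam U (Mts tau sigma) <> roumieu_fun U omega,
      forall M : nat -> R, weight_sequence M ->
        beurling_fam U (Mts tau sigma) <> beurling_seq U M
    & forall omega : R -> R, weight_function omega ->
        beurling_fam U (Mts tau sigma) <> beurling_fun U omega].
Proof.
pose i0 := Ordinal d_gt0.
set N := Mts tau sigma.
have N0 (c : R) j : 0 < c -> 0 < N c j by exact: Mts_gt0.
have Nw (x : R) : 0 < x -> weight_sequence (N x) by move=> x0 j; exact: N0.
have e0 (x : R) : 0 < expR x by exact: expR_gt0.
pose F n := N (expR (- (n%:R * tau))).
have F0 n j : 0 < F n j by exact: N0.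
have Fdec n k j : (n <= k)%N -> F k j <= F n j.
  by move=> nk; rewrite ler_Mts// ler_expR lerN2 ler_pM2r// ler_nat.
have Fabs n x : 0 <= x -> dominated (fun j => x ^+ j) (F n).
  by move=> x0; exact: expr_dominated_Mts.
have Ftouch n : exists K, touches_from K (F n) (F n.+1).
  by case: (Mts_touches_step tau_gt0 sigma_gt1 n).
have test m := moment_test_function_class i0 m U U_neq0.
have absorb := @Mts_absorb_inv R tau sigma sigma_gt1.
split.
- move=> M M0 E.
  have NM c : 0 < c -> dominated (N c) M.
    (* Touching costs e^(-tau) and leaves 2 c; the gap between c and 2 c absorbs (2 h)^j. *)
    move=> c0; pose c1 := 2 * c * expR tau.
    have c10 : 0 < c1 by rewrite mulr_gt0// mulr_gt0.
    have [K touch] := Mts_touches tau_gt0 sigma_gt1 _ c10.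
    have [m [mm mN ml]] := moment_between K _ _ (N0 c1 ^~ c10) touch.
    have [f [fM _ fN]] := test m mm.
    have [[fr _] _] := fM M M0; have [[_ fl] _] := fN N Nw.
    have /fr [h h0 mh] : roumieu_seq U M f.
      by rewrite -E; apply/fl; exists c1, 1; split=> //; rewrite expr1_weight.
    have cE : c1 * expR (- tau) = 2 * c by rewrite -mulrA -expRD subrr expR0 mulr1.
    have hM j : 0 < h ^+ j * M j by rewrite mulr_gt0 ?exprn_gt0 ?M0.
    have := ml _ hM mh; rewrite cE => NM2.
    have h2 : 0 < (2 * h)^-1 by rewrite invr_gt0 mulr_gt0.
    have c2 : c < 2 * c by lra.
    have := absorb _ _ _ c0 c2 h2.
    move=> /dominated_trans; apply.
      by move=> j; rewrite mulr_gt0 ?exprn_gt0 ?N0// mulr_gt0.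
    have := dominated_expr _ _ _ (ltW h2) NM2.
    have -> // : (fun j => (2 * h)^-1 ^+ j * (2 ^+ j * (h ^+ j * M j))) = M.
    apply/funext => j; rewrite [2 ^+ j * _]mulrA -exprMn mulrA -exprMn mulVf.
      by rewrite expr1n mul1r.
    by rewrite gt_eqF// mulr_gt0.
  pose F' n := N (expR (n%:R * tau)).
  have F'0 n j : 0 < F' n j by exact: N0.
  have F'inc n k j : (n <= k)%N -> F' n j <= F' k j.
    by move=> nk; rewrite ler_Mts// ler_expR ler_pM2r// ler_nat.
  have F'strict n : ~ dominated (F' n.+1) (F' n).
    rewrite -[F' n]expr1_weight; apply: Mts_not_absorb => //.
    by rewrite ltr_expR ltr_pM2r// ltr_nat.
  have F'touch n : exists K, touches_from K (F' n.+1) (F' n).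
    by case: (Mts_touches_step tau_gt0 sigma_gt1 n).
  have F'M n : dominated (F' n) M by exact: NM.
  (* This [m] gives a function in the class of M; in the class of the family it would be dominated
     by some e^(n tau) member. *)
  have [m [mm mM mN]] := moment_escaping F' M F'0 M0 F'inc F'strict F'touch F'M.
  have [f [fM _ fN]] := test m mm.
  have [[_ fl] _] := fM M M0; have [[fr _] _] := fN N Nw.
  have /fr [x [h [x0 h0 mh]]] : roumieu_fam U N f.
    by rewrite E; apply/fl; exists 1 => //; rewrite expr1_weight.
  have [n xn] := expR_multiple_gt tau_gt0 x.
  apply: (mN n); apply: dominated_trans mh (Mts_absorb sigma_gt1 _ _ _ x0 xn (ltW h0)).
  by move=> j; rewrite mulr_gt0 ?exprn_gt0 ?N0.
- move=> om omW E.
  (* A first test function puts M^(e^(-tau)) below 2^j W^(h) for some h; a second one, built from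
     W^(2h), puts W^(2h) below some M^(2x). *)
  have [K touch] := Mts_touches tau_gt0 sigma_gt1 1 ltr01.
  have [m [mm mN ml]] := moment_between K _ _ (N0 1 ^~ ltr01) touch.
  have [f [_ fW fN]] := test m mm.
  have [[fr _] _] := fW om; have [[_ fl] _] := fN N Nw.
  have /fr [h h0 mh] : roumieu_fun U om f.
    by rewrite -E; apply/fl; exists 1, 1; split=> //; rewrite expr1_weight.
  have NW := ml _ (omega_weight_gt0 h) mh.
  have h20 : 0 < 2 * h by rewrite mulr_gt0.
  have [m' [mm' mW' ml']] :=
    moment_between 0 _ _ (omega_weight_gt0 (2 * h)) (omega_weight_touches omW _ h20).
  have [f' [_ fW' fN']] := test m' mm'.
  have [[_ fl'] _] := fW' om; have [[fr' _] _] := fN' N Nw.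
  have /fr' [x [h' [x0 h'0 mh']]] : roumieu_fam U N f'.
    by rewrite E; apply/fl'; exists (2 * h).
  have hN j : 0 < h' ^+ j * N x j by rewrite mulr_gt0 ?exprn_gt0 ?N0.
  have := ml' _ hN mh'.
  have -> : (fun j => 2 ^+ j * (h' ^+ j * N x j)) = (fun j => (2 * h') ^+ j * N x j).
    by apply/funext => j; rewrite exprMn mulrA.
  move=> WN; have x2 : x < 2 * x by lra.
  have x20 : 0 < 2 * x by rewrite mulr_gt0.
  have h'2 : 0 < 2 * h' by rewrite mulr_gt0.
  apply: (omega_weight_not_squeezed tau_gt0 sigma_gt1 om _ _ _ h0 _ x20 NW).
    by rewrite mulr_gt0.
  apply: dominated_trans WN (Mts_absorb sigma_gt1 _ _ _ x0 x2 (ltW h'2)).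
  by move=> j; rewrite mulr_gt0 ?exprn_gt0 ?N0.
- move=> M M0 E.
  have [n FM] : exists n, dominated (F n) M.
    apply: decreasing_family_dominated => // m mm mF.
    have [f [fM _ fN]] := test m mm.
    have [_ [fr _]] := fM M M0; have [_ [_ fl]] := fN N Nw.
    rewrite -[M]expr1_weight; apply: fr => //; rewrite -E; apply/fl.
    exact: dominated_Mts_inf.
  rewrite /F in FM; set c := expR _ in FM; have c0 : 0 < c by exact: e0.
  have c20 : 0 < c / 2 by rewrite divr_gt0.
  have c2c : c / 2 < c by lra.
  (* M^(c/2) is dominated by h^j M for every h > 0, so a moment sequence below it is in the class of
     M; yet it reaches M^(c3) up to 2^j, too large for M^(c3/2). *)
  have [K touch] := Mts_touches tau_gt0 sigma_gt1 _ c20.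
  have [m [mm mN ml]] := moment_between K _ _ (N0 _ ^~ c20) touch.
  have [f [fM _ fN]] := test m mm.
  have [_ [_ fl]] := fM M M0; have [_ [fr _]] := fN N Nw.
  set c3 := c / 2 * expR (- tau) in ml; have c30 : 0 < c3 by rewrite mulr_gt0.
  have c320 : 0 < c3 / 2 by rewrite divr_gt0.
  have c32c : c3 / 2 < c3 by lra.
  have /fr /(_ _ _ c320 ltr01) mc : beurling_fam U N f.
    rewrite E; apply/fl => h h0.
    apply: dominated_trans mN _ => [j|]; first exact: N0.
    apply: dominated_trans (absorb _ _ _ c20 c2c h0) _.
      by move=> j; rewrite mulr_gt0 ?exprn_gt0 ?N0.
    by apply: dominated_expr => //; exact: ltW.
  rewrite expr1_weight in mc.
  apply: (@Mts_not_absorb R tau sigma sigma_gt1 _ _ 2 c320 c32c) => //.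
  by apply: (ml _ _ mc) => j; exact: N0.
- move=> om omW E.
  (* A countable cofinal family of parameters h -> 0, as the hump argument requires. *)
  pose W n := omega_weight (om := om) n.+1%:R^-1.
  have n0 n : 0 < n.+1%:R^-1 :> R by rewrite invr_gt0.
  have W0 n j : 0 < W n j by exact: omega_weight_gt0.
  have [n WN] : exists n, dominated (W n) (N 1).
    apply: decreasing_family_dominated => //.
    + by move=> j; exact: N0.
    + move=> n k j nk; apply: omega_weight_le => //.
      by rewrite lef_pV2 ?posrE// ler_nat.
    + by move=> n x x0; apply: omega_weight_absorb.
    + move=> n; exists 0%N => k _.
      have [a [x [a0 x0 ax Wx]]] := omega_weight_touches omW _ (n0 n) k (leq0n k).
      exists a, x; split=> //; apply: le_trans Wx; apply: omega_weight_le => //.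
      by rewrite lef_pV2 ?posrE// ler_nat.
    move=> m mm mW.
    have [f [_ fW fN]] := test m mm.
    have [_ [_ fl]] := fW om; have [_ [fr _]] := fN N Nw.
    rewrite -[N 1]expr1_weight; apply: fr => //; rewrite E; apply/fl => h h0.
    pose n := Num.Def.archi_bound h^-1.
    have nh : n.+1%:R^-1 <= h.
      rewrite invf_ple ?posrE// ltW//.
      rewrite (lt_le_trans (archi_boundP _)) ?invr_ge0 ?(ltW h0)// ler_nat.
      exact: leqnSn.
    apply: dominated_trans (mW n) _ => //.
    by exists 1 => j; rewrite mul1r; exact: omega_weight_le.
  (* Halved so that 2 h is the parameter just found, as the squeeze demands. *)
  pose h : R := (n.+1%:R^-1) / 2.
  have h0 : 0 < h by rewrite divr_gt0.
  have [k Fh] : exists k, dominated (F k) (omega_weight (om := om) h).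
    apply: decreasing_family_dominated => // [j|m mm mF]; first exact: omega_weight_gt0.
    have [f [_ fW fN]] := test m mm.
    have [_ [fr _]] := fW om; have [_ [_ fl]] := fN N Nw.
    apply: fr => //; rewrite -E; apply/fl.
    exact: dominated_Mts_inf.
  have hE : 2 * h = n.+1%:R^-1 by rewrite /h; field.
  apply: (omega_weight_not_squeezed tau_gt0 sigma_gt1 om _ _ _ h0 (e0 _) ltr01).
    apply: dominated_trans Fh _; first by move=> j; exact: omega_weight_gt0.
    by exists 1 => j; rewrite mul1r ler_peMl ?expR_ge0// exprn_ege1// ler1n.
  by rewrite hE.
Qed.
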